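(* Let $a\neq b$ be two letters of $\mathbb{A}$, and let $\tilde Z$ be obtained from $Z$ by the random transformation that picks uniformly at random one of the letters $a$ occurring in $Z=(X,Y)$ and changes it into $b$. Assume that this random transformation satisfies the following condition: there exist constants $\alpha>0$ and $\epsilon_o>0$, not depending on $n$, such that for all sufficiently large $n$ $$P\big(E[L(\tilde Z)-L(Z)\mid Z]\ge\epsilon_o\big)\ge 1-\exp[-n^{\alpha}].$$ Then there exist a constant $b_0>0$ not depending on $n$ and $n_6<\infty$ such that for every $n>n_6$ $$\mathrm{Var}[L(Z)]\ge b_0\, n.$$
   Context: Let $\mathbb{A}$ be a finite alphabet with at least two letters, and for every $n$ let $X=(X_1,\dots,X_n)$, $Y=(Y_1,\dots,Y_n)$ be such that $X_1,\dots,X_n,Y_1,\dots,Y_n$ are i.i.d. $\mathbb{A}$-valued random variables with $P(X_1=c)>0$ for every $c\in\mathbb{A}$. Put $Z:=(X,Y)$. Score: let $S:\mathbb{A}\times\mathbb{A}\to\mathbb{R}^+$ be a pairwise scoring function (nonnegative values) and let $\delta\in\mathbb{R}$ be a gap price with $\delta\le \max_{c,c'\in\mathbb{A}}S(c,c')$. An alignment is a pair $(\rho,\tau)$ of increasing integer sequences $1\le\rho_1<\dots<\rho_k\le n$, $1\le\tau_1<\dots<\tau_k\le n$ of the same length $k$ (with $0\le k\le n$). Its score is $\sum_{i=1}^kS(X_{\rho_i},Y_{\tau_i})+\delta(n-k)$, and the optimal score $L(Z)=L(X,Y)$ is the maximum over all alignments. The randomness of the transformation (the uniform choice among all positions of both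 strings carrying the letter $a$) is independent of $Z$. The transformation is only specified when $Z$ contains at least one letter $a$; as a convention, $\tilde Z:=Z$ if $Z$ contains no $a$. *)

(* Defs.v *)
From HB Require Import structures.
From mathcomp Require Export all_boot all_order all_algebra.
From mathcomp Require Export all_classical all_reals all_analysis.

Set Implicit Arguments.
Unset Strict Implicit.
Unset Printing Implicit Defensive.

Import Order.TTheory GRing.Theory Num.Theory.
Import numFieldNormedType.Exports.

Local Open Scope classical_set_scope.
Local Open Scope ring_scope.

(** * Random variables with values in a finite type *)

Definition fin_rv d (T : measurableType d) (B : finType) (W : T -> B) : Prop :=
  forall c : B, measurable (W @^-1` [set c]).

Definition independent d (T : measurableType d) (R : realType)
    (P : probability T R) (I B : finType) (W : I -> T -> B) : Prop :=
  forall (J : {set I}) (C : I -> {set B}),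
    P [set w | forall i, i \in J -> W i w \in C i] =
    (\prod_(i in J) P [set w | W i w \in C i])%E.

(** [W] is an i.i.d. family, the common law having the mass function [p]. *)
Definition iid d (T : measurableType d) (R : realType) (P : probability T R)
    (I B : finType) (p : B -> R) (W : I -> T -> B) : Prop :=
  [/\ forall i, fin_rv (W i),
      independent P W
    & forall i c, P [set w | W i w = c] = (p c)%:E].

(** [E[U | Z]] for a finite-valued [Z]: on the event [Z = z] it is
    [E[U ; Z = z] / P(Z = z)]; it takes the junk value 0 on events [Z = z] of
    probability zero. *)
Definition cond_expect d (T : measurableType d) (R : realType)
    (P : probability T R) (B : finType) (U : T -> R) (Z : T -> B) (w : T) : R :=
  fine (\int[P]_(x in Z @^-1` [set Z w]) (U x)%:E)%E
    / fine (P (Z @^-1` [set Z w])).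

(** * Pairs of strings and their alignments *)

(** The two strings of length [n]; letters are numbered from 0. *)
Definition strings (A : finType) (n : nat) : finType :=
  ({ffun 'I_n -> A} * {ffun 'I_n -> A})%type.

(** Positions in the pair: [inl i] is in the first string, [inr i] in the
    second. *)
Definition pos (n : nat) : finType := ('I_n + 'I_n)%type.

Definition letter (A : finType) n (z : strings A n) (i : pos n) : A :=
  match i with inl j => z.1 j | inr j => z.2 j end.

Definition of_letters (A : finType) n (l : pos n -> A) : strings A n :=
  ([ffun j => l (inl j)], [ffun j => l (inr j)]).

Definition increasing k n (r : {ffun 'I_k -> 'I_n}) : bool :=
  [forall i : 'I_k, forall j : 'I_k, (i < j)%N ==> (r i < r j)%N].

Definition score (A : finType) (R : realType) (S : A -> A -> R) (delta : R)
    n (z : strings A n) k (rho tau : {ffun 'I_k -> 'I_n}) : R :=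
  \sum_(i < k) S (z.1 (rho i)) (z.2 (tau i)) + delta * (n - k)%N%:R.

(** The base value [delta * n] of the iterated maxima is the score of the empty
    alignment ([k = 0]), so that this is the maximum over all alignments even
    when scores are negative. *)
Definition opt_score (A : finType) (R : realType) (S : A -> A -> R) (delta : R)
    n (z : strings A n) : R :=
  \big[Num.max/delta * n%:R]_(k < n.+1)
    \big[Num.max/delta * n%:R]_(al : {ffun 'I_k -> 'I_n} * {ffun 'I_k -> 'I_n}
                                | increasing al.1 && increasing al.2)
      score S delta z al.1 al.2.

(** The base value 0 is harmless: it is used for nonnegative scores over a
    nonempty alphabet only. *)
Definition max_score (A : finType) (R : realType) (S : A -> A -> R) : R :=
  \big[Num.max/0]_(cc : A * A) S cc.1 cc.2.

(** * The random change of one letter [a] into [b] *)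

Definition occ (A : finType) n (a : A) (z : strings A n) : {set pos n} :=
  [set i | letter z i == a].

Definition change (A : finType) n (z : strings A n) (i : pos n) (b : A) :
    strings A n :=
  of_letters (fun j => if j == i then b else letter z j).

(** The probability that the transformation turns [z] into [z']. *)
Definition change_prob (A : finType) (R : realType) n (a b : A)
    (z z' : strings A n) : R :=
  if occ a z == finset.set0 then (z' == z)%:R
  else \sum_(i in occ a z) #|occ a z|%:R^-1 * (z' == change z i b)%:R.

(** [Zt] is obtained from [Z] by the random transformation: given [Z = z], it
    has the law [change_prob a b z]. Equivalently, the random choice made by the
    transformation depends on [Z] only through the set of positions among which
    it is uniform. *)
Definition random_change d (T : measurableType d) (R : realType)
    (P : probability T R) (A : finType) n (a b : A) (Z Zt : T -> strings A n) :
    Prop :=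
  fin_rv Zt /\
  forall z z' : strings A n,
    P [set w | Z w = z /\ Zt w = z'] =
    (P [set w | Z w = z] * (change_prob R a b z z')%:E)%E.

(* Main.v *)
Require Import Defs.
From mathcomp Require Import all_boot all_order all_algebra.
From mathcomp Require Import all_classical all_reals all_analysis.
From mathcomp Require Import ring lra.

Set Implicit Arguments.
Unset Strict Implicit.
Unset Printing Implicit Defensive.

Import Order.TTheory GRing.Theory Num.Theory.
Import numFieldNormedType.Exports.

Local Open Scope classical_set_scope.
Local Open Scope ring_scope.

(** Write [N_a], [N_b] for the numbers of letters [a] and [b] among the [2n]
    letters of [Z], [L] for the optimal score, and
    [D = E[L(Zt) - L(Z) | Z]].  The proof tests [L] against the linear statistic
    [h = (p a / p b) N_b - N_a] ([balance]), whose variance is of order [n] and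
    whose covariance with [L] turns out to be exactly [E[N_a D]].

    The reason is an integration by parts ([integration_by_parts]): changing a
    letter [a] at a fixed position into [b] is a bijection from the strings with
    [a] there onto those with [b] there, and it multiplies the weight of a
    string by [p b / p a].  Summing over the positions gives, for every function
    [G] of the strings,
      [E[sum over the positions i of a in Z of (G(Z with b at i) - G(Z))]
       = E[h(Z) G(Z)]].
    Three choices of [G] suffice.
    - [G = 1] gives [E h = 0].
    - [G = h]: each change raises [h] by [p a / p b + 1], so
      [E h^2 = (p a / p b + 1) E N_a = 2n p a (p a / p b + 1)].
    - [G = L]: the inner sum is [N_a D] ([cond_expect_change]), hence
      [Cov(L, h) = E[N_a D]].

    By assumption [D >= eps] outside an event of probability at most
    [exp(- n^alpha)]; on that event [N_a D] is at worst of order [- n^2], because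
    [L] is of order [n].  As [n^2 exp(- n^alpha)] is bounded
    ([expR_powR_tail]), [Cov(L, h) >= eps (p a) n] for large [n]
    ([covariance_balance_ge]).  Expanding
    [E (L - E L - t h)^2 >= 0] gives
    [Var L >= 2 t Cov(L, h) - t^2 E h^2] ([second_moment_ge]), which is linear
    in [n] for a suitable constant [t > 0].  All expectations are finite sums
    over the strings, weighted by products of letter probabilities
    ([mass_strings]). *)

(** * Finite-valued random variables *)

Definition mass d (T : measurableType d) (R : realType) (P : probability T R)
    (B : finType) (W : T -> B) (c : B) : R := fine (P (W @^-1` [set c])).

Section FinRv.
Context d (T : measurableType d) (R : realType) (P : probability T R).
Context (B : finType) (W : T -> B) (hW : fin_rv W).

(** The domain [D] serves conditional expectations, which integrate one
    finite-valued variable over a level set of another one. *)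
Lemma integral_fin_rv (D : set T) (f : B -> R) : measurable D ->
  (\int[P]_(x in D) (f (W x))%:E =
   (\sum_c f c * fine (P (W @^-1` [set c] `&` D)))%:E)%E.
Proof.
move=> mD.
have fE x : ((f (W x))%:E = \sum_c (f c)%:E * (\1_(W @^-1` [set c]) x)%:E)%E.
  rewrite (bigD1 (W x)) //= big1 ?adde0; last first.
    move=> c /eqP cW; rewrite indicE memNset ?mule0 //= => Wc.
    by apply: cW; rewrite Wc.
  by rewrite indicE mem_set //= mule1.
have iI c : P.-integrable D (fun x => (\1_(W @^-1` [set c]) x)%:E).
  apply: (@integrableS _ _ _ _ setT) => //; exact/integrable_indic.
under eq_integral do rewrite fE.
rewrite integral_sum //; last by move=> c; apply: integrableZl.
rewrite -sumEFin; apply: eq_bigr => c _.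
rewrite integralZl // integral_indic // EFinM fineK //.
by rewrite fin_num_measure //; apply: measurableI.
Qed.

Lemma expectation_fin_rv (f : B -> R) :
  'E_P[fun x => f (W x)]%E = (\sum_c f c * mass P W c)%:E.
Proof.
rewrite unlock (@integral_fin_rv setT) //.
by under eq_bigr do rewrite setIT.
Qed.

Lemma variance_fin_rv (f : B -> R) :
  variance P (fun x => f (W x)) =
  (\sum_c (f c - \sum_c' f c' * mass P W c') ^+ 2 * mass P W c)%:E.
Proof.
rewrite /variance unlock expectation_fin_rv /=.
by rewrite -expectation_fin_rv; congr expectation; apply/funext.
Qed.

Lemma prob_fin_rv (Q : pred B) :
  P [set w | Q (W w)] = (\sum_(c | Q c) mass P W c)%:E.
Proof.
have mQ : measurable [set w | Q (W w)].
  rewrite (_ : [set w | Q (W w)] = \big[setU/set0]_(c | Q c) (W @^-1` [set c])).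
    by apply: bigsetU_measurable => c _; exact: hW.
  apply/seteqP; split=> w /=.
    by move=> Qw; rewrite (bigD1 (W w)) //=; left.
  by elim/big_ind: _ => // [? ? h1 h2 [/h1|/h2]|c Qc ->].
rewrite -[LHS](@expectation_indic _ _ _ P _ mQ).
rewrite (_ : \1_ _ = fun x => (Q (W x))%:R); last first.
  apply/funext => x; rewrite indicE.
  by have [Qx|/negP Qx] := boolP (Q (W x)); [rewrite mem_set|rewrite memNset].
rewrite (expectation_fin_rv (fun c => (Q c)%:R)); congr EFin.
rewrite [RHS]big_mkcond; apply: eq_bigr => c _.
by case: (Q c); rewrite ?mul1r ?mul0r.
Qed.

Lemma sum_mass : \sum_c mass P W c = 1.
Proof.
apply: EFin_inj; rewrite -(prob_fin_rv xpredT) -(probability_setT P).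
by congr (P _); apply/seteqP.
Qed.

Lemma massE c : P (W @^-1` [set c]) = (mass P W c)%:E.
Proof. by rewrite fineK // fin_num_measure. Qed.

End FinRv.

(** * Integration by parts over random strings *)

Section Strings.
Context (R : realType) (A : finType) (n : nat).
Implicit Types (z : strings A n) (i : pos n) (a b : A).

Lemma letter_of_letters (l : pos n -> A) i : letter (of_letters l) i = l i.
Proof. by case: i => i /=; rewrite ffunE. Qed.

Lemma stringsP z z' : (forall i, letter z i = letter z' i) -> z = z'.
Proof.
case: z z' => [x y] [x' y'] e; congr pair; apply/ffunP => j.
  exact: (e (inl j)).
exact: (e (inr j)).
Qed.

Lemma letter_change z i b j :
  letter (change z i b) j = if j == i then b else letter z j.
Proof. exact: letter_of_letters. Qed.

Lemma changeK z i a b : letter z i = a -> change (change z i b) i a = z.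
Proof.
move=> zi; apply: stringsP => j; rewrite !letter_change.
by case: eqP => // ->.
Qed.

Definition weight (p : A -> R) z : R := \prod_i p (letter z i).

(** Stated without division, so that it holds for any [p]. *)
Lemma weight_change (p : A -> R) z i b :
  p (letter z i) * weight p (change z i b) = p b * weight p z.
Proof.
rewrite /weight (bigD1 i) //= [in RHS](bigD1 i) //= letter_change eqxx.
rewrite mulrCA; congr (_ * (_ * _)).
by apply: eq_bigr => j /negPf ji; rewrite letter_change ji.
Qed.

Context (p : A -> R) (hp : forall c, 0 < p c).

Lemma weight_gt0 z : 0 < weight p z.
Proof. by apply: prodr_gt0. Qed.

(** One-site change of variables: [change _ i b] maps the strings with [a] at
    [i] bijectively onto those with [b] at [i], with inverse [change _ i a], and
    only the factor of the site [i] in the weight is affected. *)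
Lemma sum_weight_change a b i (G : strings A n -> R) :
  \sum_(z | letter z i == a) weight p z * G (change z i b) =
  p a / p b * \sum_(z | letter z i == b) weight p z * G z.
Proof.
rewrite mulr_sumr.
rewrite (reindex_onto (fun z => change z i a) (fun z => change z i b)) /=;
  last by move=> z /eqP; exact: changeK.
apply: eq_big => z.
  rewrite letter_change !eqxx /=; apply/eqP/eqP => [<-|]; last exact: changeK.
  by rewrite letter_change eqxx.
case/andP=> _ /eqP zK; rewrite zK mulrA; congr (_ * _).
have zi : letter z i = b by rewrite -zK letter_change eqxx.
apply: (mulfI (lt0r_neq0 (hp b))).
rewrite -{1}zi weight_change mulrA [p b * _]mulrC divfK //.
exact: lt0r_neq0.
Qed.

(** [#|occ a z|] times the mean increment of [G] under the random change; left
    unnormalized because this is the form in which integration by parts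
    produces it, and because it vanishes by itself when [a] does not occur. *)
Definition change_diff a b (G : strings A n -> R) z : R :=
  \sum_(i in occ a z) (G (change z i b) - G z).

(** The weights of [N_b] and [N_a] are those for which the expectation vanishes
    and the operator [change_diff] is dual to multiplication by [balance]. *)
Definition balance a b z : R :=
  p a / p b * #|occ b z|%:R - #|occ a z|%:R.

Lemma sum_occ a (F : strings A n -> pos n -> R) :
  \sum_z \sum_(i in occ a z) F z i = \sum_i \sum_(z | letter z i == a) F z i.
Proof.
rewrite (exchange_big_dep predT) //=; apply: eq_bigr => i _.
by apply: eq_bigl => z; rewrite inE.
Qed.

Lemma sum_occ_const a (F : strings A n -> R) :
  \sum_z F z * #|occ a z|%:R = \sum_i \sum_(z | letter z i == a) F z.
Proof.
rewrite -(sum_occ a (fun z _ => F z)); apply: eq_bigr => z _.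
by rewrite sumr_const mulr_natr.
Qed.

(** For each position, the terms [G (change z i b)] become, by the one-site
    change of variables, a sum over the strings with [b] there; counting
    positions turns the sum over [i] into the factors [#|occ b z|] and
    [#|occ a z|]. *)
Lemma integration_by_parts a b (G : strings A n -> R) :
  \sum_z weight p z * change_diff a b G z =
  \sum_z weight p z * (balance a b z * G z).
Proof.
transitivity (\sum_i (\sum_(z | letter z i == a) weight p z * G (change z i b)
                     - \sum_(z | letter z i == a) weight p z * G z)).
  under eq_bigr do rewrite mulr_sumr.
  rewrite sum_occ; apply: eq_bigr => i _.
  by rewrite -sumrB; apply: eq_bigr => z _; rewrite mulrBr.
under eq_bigr do rewrite sum_weight_change.
rewrite sumrB -mulr_sumr -!sum_occ_const mulr_sumr -sumrB.
by apply: eq_bigr => z _; rewrite /balance; ring.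
Qed.

Lemma balance_change a b z i : a <> b -> letter z i = a ->
  balance a b (change z i b) = balance a b z + (p a / p b + 1).
Proof.
move=> /eqP ab zi; have ba : b == a = false by apply/negbTE; rewrite eq_sym.
have ob : occ b (change z i b) = (i |: occ b z)%SET.
  apply/setP => j; rewrite !inE letter_change.
  by case: (j =P i) => [->|]; rewrite ?eqxx.
have oa : occ a z = (i |: occ a (change z i b))%SET.
  apply/setP => j; rewrite !inE letter_change.
  by case: (j =P i) => [->|//]; rewrite zi eqxx.
rewrite /balance ob oa !cardsU1 !inE letter_change eqxx zi ba (negPf ab) /=.
by rewrite !natrD; ring.
Qed.

Lemma change_diff_cst a b (c : R) z : change_diff a b (cst c) z = 0.
Proof. by rewrite /change_diff big1 // => i _; rewrite subrr. Qed.

Lemma change_diff_balance a b z : a <> b ->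
  change_diff a b (balance a b) z = (p a / p b + 1) * #|occ a z|%:R.
Proof.
move=> ab; rewrite /change_diff mulr_natr -sumr_const.
apply: eq_bigr => i; rewrite inE => /eqP zi.
by rewrite balance_change // addrAC subrr add0r.
Qed.

(** Integration by parts against a constant, whose increments vanish. *)
Lemma sum_weight_balance a b : \sum_z weight p z * balance a b z = 0.
Proof.
have := integration_by_parts a b (cst 1).
rewrite big1 => [|z _]; last first.
  by rewrite change_diff_cst mulr0.
by move=> e; rewrite [RHS]e; apply: eq_bigr => z _; rewrite mulr1.
Qed.

Lemma sum_change_prob a b (F : strings A n -> R) z :
  \sum_z' F z' * change_prob R a b z z' =
  if occ a z == finset.set0 then F z
  else #|occ a z|%:R^-1 * \sum_(i in occ a z) F (change z i b).
Proof.
rewrite /change_prob; case: ifP => _.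
  rewrite (bigD1 z) //= eqxx mulr1 big1 ?addr0 // => z' /negPf ->.
  by rewrite mulr0.
under eq_bigr do rewrite mulr_sumr.
rewrite exchange_big /= mulr_sumr; apply: eq_bigr => i _.
rewrite (bigD1 (change z i b)) //= eqxx mulr1 mulrC big1 ?addr0 //.
by move=> z' /negPf ->; rewrite !mulr0.
Qed.

Lemma card_occ_le a z : (#|occ a z| <= n.*2)%N.
Proof.
apply: leq_trans (max_card _) _.
by rewrite card_sum card_ord addnn.
Qed.

End Strings.

(** * Estimates *)

Lemma opt_score_ge (A : finType) (R : realType) (S : A -> A -> R) (delta : R)
    n (z : strings A n) : delta * n%:R <= opt_score S delta z.
Proof. exact: bigmax_ge_id. Qed.

Lemma opt_score_le (A : finType) (R : realType) (S : A -> A -> R) (delta : R)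
    n (z : strings A n) :
  opt_score S delta z <= (max_score S + `|delta|) * n%:R.
Proof.
have M0 : 0 <= max_score S by exact: bigmax_ge_id.
have base : delta * n%:R <= (max_score S + `|delta|) * n%:R.
  by rewrite ler_wpM2r // (le_trans (ler_norm _)) // lerDr.
apply: bigmax_le => // k _; apply: bigmax_le => // al _.
have kn : (k <= n)%N by rewrite -ltnS.
rewrite /score mulrDl lerD //.
  have -> : max_score S * n%:R = \sum_(i < n) max_score S.
    by rewrite sumr_const card_ord mulr_natr.
  rewrite (le_trans (_ : _ <= \sum_(i < k) max_score S)) //.
    apply: ler_sum => i _.
    exact: (le_bigmax _ (fun cc : A * A => S cc.1 cc.2)
      (z.1 (al.1 i), z.2 (al.2 i))).
  by rewrite !sumr_const !card_ord ler_wpMn2l.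
rewrite (le_trans (ler_wpM2r _ (ler_norm delta))) //.
by rewrite ler_wpM2l // ler_nat leq_subr.
Qed.

(** A single changed letter moves the score by a bounded amount only, but the
    crude bound of order [n] between arbitrary strings is enough against a
    stretched-exponentially small probability. *)
Lemma opt_score_diff_ge (A : finType) (R : realType) (S : A -> A -> R)
    (delta : R) n (z z' : strings A n) :
  - ((max_score S + 2 * `|delta|) * n%:R) <=
  opt_score S delta z' - opt_score S delta z.
Proof.
have lo : - (`|delta| * n%:R) <= delta * n%:R.
  by rewrite -mulNr ler_wpM2r // lerNl ler_normr lexx orbT.
have := opt_score_ge S delta z'; have := opt_score_le S delta z.
by lra.
Qed.

(** One term of the exponential series, of order [k.+1 >= 2 / alpha], already
    dominates [n ^ 2]. *)
Lemma expR_powR_tail (R : realType) (alpha : R) : 0 < alpha ->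
  exists2 K : R, 0 < K & forall n, (0 < n)%N ->
    n%:R ^+ 2 * expR (- (n%:R `^ alpha)) <= K.
Proof.
move=> a0; pose k := Num.trunc (2 / alpha).
exists (k.+1`!%:R); first by rewrite ltr0n fact_gt0.
move=> n n0; rewrite expRN ler_pdivrMr ?expR_gt0 //.
have xge0 : 0 <= n%:R `^ alpha :> R by exact: powR_ge0.
have : (n%:R `^ alpha) ^+ k.+1 / k.+1`!%:R <= expR (n%:R `^ alpha) :> R.
  by rewrite (le_trans _ (expR_ge1Dxn k xge0)) // lerDr.
rewrite ler_pdivrMr ?ltr0n ?fact_gt0 // [_ * k.+1`!%:R]mulrC.
apply: le_trans; rewrite -powR_mulrn // -powR_mulrn // -powRrM.
rewrite ler_powR ?ler1n //.
by rewrite mulrC -ler_pdivrMr // ltW // truncnS_gt.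
Qed.

(** The expansion of the nonnegative quantity [E (g - u - t h)^2], where the
    cross term in [u] vanishes because [h] is centered. This replaces the
    Cauchy-Schwarz inequality: with [u] the mean of [g], the left-hand side is
    at its best [t] the quotient [Cov(g, h)^2 / E h^2]. *)
Lemma second_moment_ge (R : realType) (B : finType) (m g h : B -> R) (u t : R) :
  (forall c, 0 <= m c) -> \sum_c m c * h c = 0 ->
  2 * t * \sum_c m c * (h c * g c) - t ^+ 2 * \sum_c m c * h c ^+ 2
  <= \sum_c (g c - u) ^+ 2 * m c.
Proof.
move=> m0 h0.
have : 0 <= \sum_c (g c - u - t * h c) ^+ 2 * m c.
  by apply: sumr_ge0 => c _; rewrite mulr_ge0 ?sqr_ge0.
have -> : \sum_c (g c - u - t * h c) ^+ 2 * m c =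
    \sum_c (g c - u) ^+ 2 * m c - 2 * t * (\sum_c m c * (h c * g c))
    + 2 * t * u * (\sum_c m c * h c) + t ^+ 2 * \sum_c m c * h c ^+ 2.
  rewrite !mulr_sumr -sumrB -!big_split /=.
  by apply: eq_bigr => c _; ring.
by rewrite h0; lra.
Qed.

(** * Random strings under the random change *)

Section RandomStrings.
Context d (T : measurableType d) (R : realType) (P : probability T R).
Context (A : finType) (n : nat) (p : A -> R) (hp : forall c, 0 < p c).
Context (V : pos n -> T -> A) (hV : iid P p V) (Z : T -> strings A n).
Context (hZ : forall i w, letter (Z w) i = V i w).

Lemma preimage_strings z :
  Z @^-1` [set z] = [set w | forall i, V i w = letter z i].
Proof.
apply/seteqP; split=> w /=; first by move=> Zw i; rewrite -hZ Zw.
by move=> Vw; apply: stringsP => i; rewrite hZ.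
Qed.

Lemma fin_rv_strings : fin_rv Z.
Proof.
move=> z; have [mV _ _] := hV.
rewrite preimage_strings.
rewrite (_ : [set w | _] = \big[setI/setT]_i (V i @^-1` [set letter z i])).
  by apply: bigsetI_measurable => i _; exact: mV.
apply/seteqP; split=> w /=.
  by move=> Vw; elim/big_ind: _ => // i _; exact: Vw.
by move=> Vw i; move: Vw; rewrite (bigD1 i) //= => -[].
Qed.

Lemma mass_strings z : mass P Z z = weight p z.
Proof.
have [_ indV lawV] := hV.
apply: EFin_inj; rewrite -massE; last exact: fin_rv_strings.
have := indV finset.setT (fun i => [set letter z i]%SET).
have -> : [set w | forall i, i \in finset.setT -> V i w \in [set letter z i]%SET] =
    Z @^-1` [set z].
  rewrite preimage_strings; apply/seteqP; split=> w /= Vw i.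
    by apply/eqP; have := Vw i (finset.in_setT i); rewrite finset.inE.
  by move=> _; rewrite Vw finset.inE.
move=> ->; rewrite /weight -prodEFin; apply: eq_big => i.
  by rewrite finset.inE.
move=> _; rewrite -(lawV i); congr (P _); apply/seteqP; split=> w /=.
  by rewrite finset.inE => /eqP.
by move=> ->; rewrite finset.inE.
Qed.

Lemma sum_weight : \sum_(z : strings A n) weight p z = 1.
Proof.
rewrite -(sum_mass P fin_rv_strings).
by apply: eq_bigr => z _; rewrite mass_strings.
Qed.

Lemma sum_weight_card_occ a :
  \sum_(z : strings A n) weight p z * #|occ a z|%:R = n.*2%:R * p a.
Proof.
have [_ _ lawV] := hV.
rewrite sum_occ_const (eq_bigr (fun=> p a)).
  by rewrite sumr_const card_sum card_ord addnn mulr_natl.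
move=> i _; apply: EFin_inj; rewrite -(lawV i).
have -> : [set w | V i w = a] = [set w | [pred z | letter z i == a] (Z w)].
  by apply/seteqP; split=> w /=; rewrite hZ => /eqP.
rewrite (prob_fin_rv P fin_rv_strings); congr EFin.
by apply: eq_bigr => z _; rewrite mass_strings.
Qed.

(** Integration by parts against [balance] itself, which every change of an [a]
    into [b] raises by the same constant; no correlations between different
    positions have to be computed. *)
Lemma sum_weight_balance_sqr a b : a <> b ->
  \sum_(z : strings A n) weight p z * balance p a b z ^+ 2 =
  (p a / p b + 1) * p a * n.*2%:R.
Proof.
move=> ab; have := integration_by_parts hp a b (balance p a b).
rewrite -(eq_bigr _ (fun z _ => congr1 (GRing.mul _) (expr2 _))) => <-.
under eq_bigr do rewrite change_diff_balance // mulrCA.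
by rewrite -mulr_sumr sum_weight_card_occ; ring.
Qed.

Context (a b : A) (Zt : T -> strings A n) (hZt : random_change P a b Z Zt).

(** When [a] does not occur in [Z w], the string is left unchanged and both sides
    are 0, the right one because the sum is empty. As all letters have positive
    probability, the junk value of the conditional expectation never occurs. *)
Lemma cond_expect_change (G : strings A n -> R) w :
  cond_expect P (fun w' => G (Zt w') - G (Z w')) Z w =
  change_diff a b G (Z w) / #|occ a (Z w)|%:R.
Proof.
have [mZt lawZt] := hZt; set z := Z w.
have mZ := fin_rv_strings z.
rewrite /cond_expect -/z.
rewrite (eq_integral (fun w' => (G (Zt w') - G z)%:E)); last first.
  by move=> w'; rewrite inE => /= ->.
rewrite (integral_fin_rv P mZt (fun z' => G z' - G z) mZ) /=.
have -> : \sum_z' (G z' - G z) * fine (P (Zt @^-1` [set z'] `&` Z @^-1` [set z])) =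
    weight p z * \sum_z' (G z' - G z) * change_prob R a b z z'.
  rewrite mulr_sumr; apply: eq_bigr => z' _; rewrite mulrCA; congr (_ * _).
  rewrite setIC (lawZt z z').
  by rewrite (massE P fin_rv_strings) mass_strings.
rewrite -[fine _]/(mass P Z z) mass_strings mulrAC divff ?mul1r; last first.
  by rewrite gt_eqF // weight_gt0.
rewrite sum_change_prob /change_diff; case: ifP => [/eqP ->|_].
  by rewrite big_set0 mul0r subrr.
by rewrite mulrC.
Qed.

(** The left-hand side is [eps * E N_a] minus the loss on the event, of
    probability at most [eta], where the drift may be below [eps]; there every
    increment is still at least [- K], and there are at most [2n] of them. *)
Lemma covariance_balance_ge (G : strings A n -> R) (eps eta K : R) :
  0 <= eps + K -> (forall z z', - K <= G z' - G z) ->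
  ((1 - eta)%:E <=
   P [set w | (eps <= cond_expect P (fun w' => G (Zt w') - G (Z w')) Z w)%R])%E ->
  n.*2%:R * (eps * p a - (eps + K) * eta) <=
  \sum_z weight p z * (balance p a b z * G z).
Proof.
move=> epsK hK hP; rewrite -integration_by_parts //.
pose Q z := eps <= change_diff a b G z / #|occ a z|%:R.
have bad : \sum_(z | ~~ Q z) weight p z <= eta.
  have QE : [set w | eps <= cond_expect P (fun w' => G (Zt w') - G (Z w')) Z w] =
      [set w | Q (Z w)].
    by apply/seteqP; split=> w /=; rewrite cond_expect_change.
  move: hP; rewrite QE (prob_fin_rv P fin_rv_strings) lee_fin.
  under eq_bigr do rewrite mass_strings.
  by have := sum_weight; rewrite (bigID Q) /=; lra.
have pointwise z : eps * #|occ a z|%:R - (eps + K) * n.*2%:R * (~~ Q z)%:R <=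
    change_diff a b G z.
  have [Qz|Qz] /= := boolP (Q z).
    rewrite mulr0 subr0; have [N0|Npos] := posnP #|occ a z|.
      by rewrite /change_diff N0 (cards0_eq N0) big_set0 mulr0.
    by rewrite -ler_pdivlMr ?ltr0n.
  have cd : - K * #|occ a z|%:R <= change_diff a b G z.
    by rewrite mulr_natr -sumr_const ler_sum.
  apply: le_trans cd; rewrite mulr1.
  have : (eps + K) * #|occ a z|%:R <= (eps + K) * n.*2%:R.
    by rewrite ler_wpM2l // ler_nat card_occ_le.
  by lra.
apply: (@le_trans _ _ (\sum_z weight p z *
    (eps * #|occ a z|%:R - (eps + K) * n.*2%:R * (~~ Q z)%:R))); last first.
  by apply: ler_sum => z _; rewrite ler_wpM2l // ltW // weight_gt0.
have -> : \sum_z weight p z *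
    (eps * #|occ a z|%:R - (eps + K) * n.*2%:R * (~~ Q z)%:R) =
    eps * (\sum_(z : strings A n) weight p z * #|occ a z|%:R) -
    (eps + K) * n.*2%:R * \sum_(z | ~~ Q z) weight p z.
  rewrite [\sum_(z | ~~ Q z) _]big_mkcond /= !mulr_sumr -sumrB.
  by apply: eq_bigr => z _; case: (Q z) => /=; ring.
rewrite sum_weight_card_occ.
have : (eps + K) * n.*2%:R * \sum_(z | ~~ Q z) weight p z <=
    (eps + K) * n.*2%:R * eta by rewrite ler_wpM2l // mulr_ge0.
by lra.
Qed.

Lemma variance_strings_ge (G : strings A n -> R) (t C : R) : a <> b ->
  0 <= t -> C <= \sum_z weight p z * (balance p a b z * G z) ->
  ((2 * t * C - t ^+ 2 * ((p a / p b + 1) * p a * n.*2%:R))%:E <=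
   variance P (fun w => G (Z w)))%E.
Proof.
move=> ab t0 hC; rewrite (variance_fin_rv P fin_rv_strings) lee_fin.
under eq_bigr do rewrite mass_strings.
apply: le_trans (second_moment_ge _ _ t _ (@sum_weight_balance R A n p hp a b));
    last first.
  by move=> z; rewrite ltW // weight_gt0.
by rewrite sum_weight_balance_sqr // lerB // ler_wpM2l // mulr_ge0.
Qed.

End RandomStrings.

(** * The variance bound *)

Theorem theorem3p2 (R : realType) (A : finType) (hA : (2 <= #|A|)%N)
    (p : A -> R) (hp : forall c, 0 < p c)
    (S : A -> A -> R) (hS : forall c c', 0 <= S c c')
    (delta : R) (hdelta : delta <= max_score S)
    (d : nat -> measure_display) (T : forall n, measurableType (d n))
    (P : forall n, probability (T n) R)
    (X Y : forall n, 'I_n -> T n -> A)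
    (hXY : forall n, iid (P n) p
       (fun i : pos n => match i with inl j => X n j | inr j => Y n j end))
    (Z : forall n, T n -> strings A n)
    (hZ : forall n w, Z n w = ([ffun i => X n i w], [ffun i => Y n i w]))
    (a b : A) (hab : a <> b)
    (Zt : forall n, T n -> strings A n)
    (hZt : forall n, random_change (P n) a b (Z n) (Zt n)) :
  (exists alpha epso : R, 0 < alpha /\ 0 < epso /\
    exists n0 : nat, forall n : nat, (n0 <= n)%N ->
      ((1 - expR (- (n%:R `^ alpha)))%:E <=
       P n [set w | (epso <=
              cond_expect (P n)
                (fun w' => opt_score S delta (Zt n w')
                           - opt_score S delta (Z n w')) (Z n) w)%R])%E) ->
  exists b0 : R, 0 < b0 /\
    exists n6 : nat, forall n : nat, (n6 < n)%N ->
      ((b0 * n%:R)%:E <=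
       variance (P n) (fun w => opt_score S delta (Z n w)))%E.
Proof.
case=> alpha [eps [alpha_gt0 [eps_gt0 [n0 drift]]]].
have pa := hp a; have pb := hp b.
pose c := max_score S + 2 * `|delta|.
have c_ge0 : 0 <= c by rewrite addr_ge0 ?mulr_ge0 // bigmax_ge_id.
have [K K_gt0 tail] := expR_powR_tail alpha_gt0.
pose r := eps * p a.
have r_gt0 : 0 < r by exact: mulr_gt0.
(* [v * n] is the second moment of [balance]. *)
pose v := 2 * ((p a / p b + 1) * p a).
have v_gt0 : 0 < v by rewrite !mulr_gt0 // addr_gt0 // divr_gt0.
exists (r ^+ 2 / v); split; first by rewrite divr_gt0 ?exprn_gt0.
(* From this size on, the loss on the exceptional event is at most half of the
   main term [2 n r]. *)
pose x := 2 * (eps + c) * K / r.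
exists (maxn n0 (Num.trunc x)) => n; rewrite gtn_max => /andP[n0n xn].
have n_gt0 : (0 < n)%N by exact: leq_ltn_trans xn.
have {xn} x_le : x <= n%:R.
  by apply: le_trans (ltW (truncnS_gt x)) _; rewrite ler_nat.
have nR : 1 <= n%:R :> R by rewrite ler1n.
pose eta : R := expR (- (n%:R `^ alpha)).
have eta_small : (eps + c * n%:R) * eta <= r / 2.
  have eta0 : 0 <= eta by exact: expR_ge0.
  have step : (eps + c * n%:R) * eta <= (eps + c) * (n%:R * eta).
    rewrite mulrA ler_wpM2r //.
    have : eps * 1 <= eps * n%:R by rewrite ler_wpM2l // ltW.
    by lra.
  apply: (le_trans step).
  have ec : 0 < eps + c by rewrite ltr_wpDr.
  rewrite -(ler_pM2r (lt_le_trans ltr01 nR)).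
  have := tail n n_gt0; rewrite -/eta => h.
  have h1 := ler_wpM2l (ltW ec) h.
  move: x_le; rewrite /x ler_pdivrMr // => h2.
  by lra.
have letterZ i w : letter (Z n w) i =
    match i with inl j => X n j | inr j => Y n j end w.
  by rewrite hZ; case: i => j /=; rewrite ffunE.
have cov := covariance_balance_ge hp (hXY n) letterZ (hZt n)
  (eta := eta) _ (opt_score_diff_ge S delta (n := n)) (drift n (ltnW n0n)).
have {}cov : r * n%:R <= \sum_(z : strings A n) weight p z *
    (balance p a b z * opt_score S delta z).
  apply: le_trans (cov _); last by rewrite addr_ge0 ?mulr_ge0 ?(ltW eps_gt0).
  rewrite -/c -/r -muln2 natrM.
  have h : n%:R * ((eps + c * n%:R) * eta) <= n%:R * (r / 2).
    by rewrite ler_wpM2l.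
  by lra.
(* [t = r / v] maximizes [2 t (r n) - t ^ 2 (v n)], with value [r ^ 2 / v * n]. *)
apply: le_trans (variance_strings_ge (t := r / v) hp (hXY n) letterZ hab _ cov).
  rewrite lee_fin -muln2 natrM le_eqVlt; apply/orP; left; apply/eqP.
  rewrite [_ * (n%:R * 2)](_ : _ = v * n%:R); last by rewrite /v; ring.
  by field; rewrite gt_eqF.
by rewrite divr_ge0 // ltW.
Qed.
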